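(* Let $\mathcal{P}$ be a polyomino. Then $\mathcal{P}$ is simple if and only if $\mathcal{P}$ is balanced.
   Context: $\mathbb{N}$ denotes the nonnegative integers. On $\mathbb{Z}^2$ (and $\mathbb{N}^2$) use the componentwise partial order: $(x,y)\le(z,w)$ iff $x\le z$ and $y\le w$. For lattice points $a\le b$, the interval $[a,b]$ is the set of lattice points $c$ with $a\le c\le b$. If $a=(i,j)$, $b=(k,l)$ with $i<k$ and $j<l$, then $a,b$ are the diagonal corners of $[a,b]$ and $(i,l),(k,j)$ are its anti-diagonal corners. A cell is an interval $C=[a,a+(1,1)]$; its four elements are its vertices, forming the set $V(C)$, and its edges are the intervals $[a,a+(1,0)]$, $[a+(1,0),a+(1,1)]$, $[a+(0,1),a+(1,1)]$, $[a,a+(0,1)]$. A polyomino is a (nonempty) finite collection $\mathcal{P}$ of cells of $\mathbb{N}^2$ such that any two cells $C,D\in\mathcal{P}$ are connected by a sequence $C=C_1,\dots,C_t=D$ of cells of $\mathcal{P}$ with $C_i$ and $C_{i+1}$ intersecting in an edge for all $i$. Its vertex set is $V(\mathcal{P})=\bigcup_{C\in\mathcal{P}}V(C)$. A rectangular polyomino is the collection of all cells inside an interval. Simple: Let $\mathcal{I}$ be a rectangular polyomino with $\mathcal{P}\subset\mathcal{I}$. $\mathcal{P}$ is simple if for every cell $C\notin\mathcal{P}$ there is a sequence of pairwise distinct cells $C=C_1,C_2,\dots,C_t=D$, consecutive ones intersecting in an edge, with $C_i\notin\mathcal{P}$ for all $i$ and $D$ not a cell of $\mathcal{I}$ (cells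 $C_i$ are allowed to be cells of $\mathbb{Z}^2$). Edge intervals: a horizontal edge interval of $\mathcal{P}$ is an interval $[(i,j),(k,j)]$ with $i<k$ such that $[(t,j),(t+1,j)]$ is an edge of a cell of $\mathcal{P}$ for $t=i,\dots,k-1$; vertical edge intervals are defined analogously. Maximal means maximal under inclusion. Admissible labeling: a function $\alpha:V(\mathcal{P})\to\mathbb{Z}$ such that $\sum_{a\in I}\alpha(a)=0$ for every maximal horizontal edge interval and every maximal vertical edge interval $I$ of $\mathcal{P}$. Balanced: Let $K$ be a field and $S=K[x_a : a\in V(\mathcal{P})]$. An inner interval of $\mathcal{P}$ is an interval $[a,b]$ (with $a=(i,j)$, $b=(k,l)$, $i<k$, $j<l$) all of whose cells belong to $\mathcal{P}$. The polyomino ideal $I_{\mathcal{P}}\subset S$ is generated by all inner minors $x_ax_b-x_cx_d$, where $[a,b]$ is an inner interval of $\mathcal{P}$ with anti-diagonal corners $c,d$. For an admissible labeling $\alpha$, put $\alpha^+(a)=\max(\alpha(a),0)$, $\alpha^-(a)=\max(-\alpha(a),0)$, and $f_\alpha=\prod_{a\in V(\mathcal{P})}x_a^{\alpha^+(a)}-\prod_{a\in V(\mathcal{P})}x_a^{\alpha^-(a)}$. $\mathcal{P}$ is balanced if $f_\alpha\in I_{\mathcal{P}}$ for every admissible labeling $\alpha$ of $\mathcal{P}$. *)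

(* Defs.v *)
From mathcomp Require Import all_boot all_order all_algebra.
From mathcomp Require Import finmap.
From mathcomp.multinomials Require Import mpoly.

Set Implicit Arguments.
Unset Strict Implicit.
Unset Printing Implicit Defensive.

Import Order.TTheory GRing.Theory Num.Theory.
Local Open Scope fset_scope.
Local Open Scope ring_scope.

Notation point := (int * int)%type.

(* A cell [C, C + (1, 1)] is represented by its lower left corner C. *)
Notation cell := (int * int)%type (only parsing).

Definition lep (a b : point) : bool := (a.1 <= b.1) && (a.2 <= b.2).

Definition lattice_interval (a b : point) : {pred point} :=
  [pred c | lep a c && lep c b].

Definition vertices (C : cell) : {fset point} :=
  [fset C; C + (1, 0); C + (0, 1); C + (1, 1)].

(* An edge is given by the set of its two end points. *)
Definition hedge (a : point) : {fset point} := [fset a; a + (1, 0)].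
Definition vedge (a : point) : {fset point} := [fset a; a + (0, 1)].

Definition edges (C : cell) : seq {fset point} :=
  [:: hedge C; vedge (C + (1, 0)); hedge (C + (0, 1)); vedge C].

Definition cell_adj : rel cell := fun C D =>
  let e := vertices C `&` vertices D in (e \in edges C) && (e \in edges D).

Definition cell_in (a b : point) (C : cell) : Prop :=
  {subset vertices C <= lattice_interval a b}.

Definition polyomino (P : {fset cell}) : Prop :=
  [/\ P != fset0,
      {in P, forall C, lep 0 C}
    & {in P &, forall C D, exists s : seq cell,
        [/\ path cell_adj C s, {subset s <= P} & last C s = D]}].

Definition rectangular (I : {fset cell}) : Prop :=
  polyomino I /\ exists a b : point, forall C : cell, C \in I <-> cell_in a b C.

(* The condition does not depend on the choice of I: the complement of a
   rectangle is connected in Z^2. *)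
Definition simple_polyomino (P : {fset cell}) : Prop :=
  exists I : {fset cell},
    [/\ rectangular I, P `<=` I
      & forall C : cell, C \notin P ->
        exists s : seq cell,
          [/\ uniq (C :: s), path cell_adj C s,
              {in C :: s, forall D, D \notin P} & last C s \notin I]].

Definition polyomino_vertices (P : {fset cell}) : {fset point} :=
  \bigcup_(C <- P) vertices C.

Definition edge_of (P : {fset cell}) (e : {fset point}) : Prop :=
  exists2 C, C \in P & e \in edges C.

Definition hedge_interval (P : {fset cell}) (a b : point) : Prop :=
  [/\ a.2 = b.2, a.1 < b.1
    & forall t : int, a.1 <= t < b.1 -> edge_of P (hedge (t, a.2))].

Definition vedge_interval (P : {fset cell}) (a b : point) : Prop :=
  [/\ a.1 = b.1, a.2 < b.2
    & forall t : int, a.2 <= t < b.2 -> edge_of P (vedge (a.1, t))].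

Definition maximal_interval (E : point -> point -> Prop) (a b : point) : Prop :=
  E a b /\
  forall a' b' : point, E a' b' ->
    {subset lattice_interval a b <= lattice_interval a' b'} ->
    {subset lattice_interval a' b' <= lattice_interval a b}.

Definition admissible (P : {fset cell})
    (alpha : polyomino_vertices P -> int) : Prop :=
  forall a b : point,
    maximal_interval (hedge_interval P) a b \/
    maximal_interval (vedge_interval P) a b ->
    \sum_(v : polyomino_vertices P | val v \in lattice_interval a b)
      alpha v = 0.

Definition inner_interval (P : {fset cell}) (a b : point) : Prop :=
  [/\ a.1 < b.1, a.2 < b.2 & forall C : cell, cell_in a b C -> C \in P].

(* The polynomial ring K[x_v : v in V(P)], its variables being numbered by an
   enumeration of V(P). *)
Notation polyomino_ring K P := {mpoly K[#|{: polyomino_vertices P}|]}.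

Definition xvar (K : fieldType) (P : {fset cell}) (v : polyomino_vertices P) :
  polyomino_ring K P := 'X_(enum_rank v).

Definition inner_minor (K : fieldType) (P : {fset cell})
    (g : polyomino_ring K P) : Prop :=
  exists a b c d : polyomino_vertices P,
    [/\ inner_interval P (val a) (val b),
        val c = ((val a).1, (val b).2), val d = ((val b).1, (val a).2)
      & g = xvar K a * xvar K b - xvar K c * xvar K d].

Definition generated_ideal (R : comNzRingType) (G : R -> Prop) (f : R) : Prop :=
  exists s : seq (R * R),
    {in s, forall p, G p.2} /\ f = \sum_(p <- s) p.1 * p.2.

Definition polyomino_ideal (K : fieldType) (P : {fset cell}) :
  polyomino_ring K P -> Prop := generated_ideal (@inner_minor K P).

Definition pos_part (z : int) : nat := absz (Num.max z 0).

Definition label_binomial (K : fieldType) (P : {fset cell})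
    (alpha : polyomino_vertices P -> int) : polyomino_ring K P :=
  \prod_(v : polyomino_vertices P) xvar K v ^+ pos_part (alpha v) -
  \prod_(v : polyomino_vertices P) xvar K v ^+ pos_part (- alpha v).

Definition balanced (K : fieldType) (P : {fset cell}) : Prop :=
  forall alpha : polyomino_vertices P -> int,
    admissible alpha -> polyomino_ideal (label_binomial K alpha).

(* Main.v *)
(* To a labeling [alpha] of the vertices attach the potential [w] on cells,
   where [w C] is the sum of [alpha] over the vertices weakly to the left of [C]
   and strictly above it.  If the sums of [alpha] over maximal edge intervals
   vanish, then [w] has the same value on two adjacent cells outside [P], and
   [w = 0] outside a rectangle containing [P].

   Simple implies balanced.  Here [w] vanishes on all cells outside [P].  Let [u]
   and [v] be monomials with the same degree on every maximal interval; by
   induction on the degree, [u] and [v] are congruent modulo the ideal.  If a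
   proper part of [u] matches a proper part of [v], use induction; so assume that
   there is no such part.  Then a horizontal interval in the top row meets [u] in
   a single point [p] and [v] in a single point [q], and [w] is a nonzero constant
   on the cells just below the segment [p q].  The largest rectangle below this
   segment on which [w] keeps that value is therefore inner; its lower side [a b]
   lies in an interval meeting [u] and [v].  The pair [u a / p], [v b / q] now has
   a proper matching part, and the inner minor of the rectangle carries the
   resulting congruences back to [u] and [v].

   Balanced implies simple.  The indicator function [w] of a bounded component of
   the complement of [P] is the potential, up to sign, of an admissible labeling;
   its binomial is not in the ideal, because for a cell [C] of that component the
   total degree in the variables weakly to the left of [C] and strictly above it
   is a grading for which all inner minors are homogeneous, but not the binomial. *)

Require Import Defs.
From mathcomp Require Import all_boot all_order all_algebra.
From mathcomp Require Import finmap.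
From mathcomp.multinomials Require Import mpoly.
From mathcomp Require Import zify.
From Stdlib Require Import ClassicalEpsilon.

Set Implicit Arguments.
Unset Strict Implicit.
Unset Printing Implicit Defensive.

Import Order.TTheory GRing.Theory Num.Theory.
Local Open Scope fset_scope.
Local Open Scope ring_scope.

(** * Matching monomials *)

Section Balanced.
Context {n : nat} {A B : finType} (h : 'I_n -> A) (g : 'I_n -> B).
Implicit Types u v w : 'X_{1..n}.

Definition marginal (T : finType) (f : 'I_n -> T) (t : T) u : nat :=
  (\sum_(i | f i == t) u i)%N.

(** In the application [h] and [g] send a vertex to its maximal horizontal and vertical edge
    interval, and [u], [v] are the exponents of the two terms of the binomial of an admissible
    labeling. *)
Definition same_marginals u v : Prop :=
  marginal h ^~ u =1 marginal h ^~ v /\ marginal g ^~ u =1 marginal g ^~ v.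

Lemma marginalD (T : finType) (f : 'I_n -> T) t u v :
  marginal f t (u + v)%MM = (marginal f t u + marginal f t v)%N.
Proof. by rewrite -big_split; apply: eq_bigr => i _; rewrite mnmDE. Qed.

Lemma marginalU (T : finType) (f : 'I_n -> T) t i :
  marginal f t U_(i)%MM = (f i == t).
Proof.
rewrite /marginal; case: (boolP (f i == t)) => it.
  rewrite (bigD1 i) //= mnm1E eqxx big1 ?addn0 // => j /andP[_ ji].
  by rewrite mnm1E eq_sym (negbTE ji).
by rewrite big1 // => j jt; rewrite mnm1E; case: eqP => // ij; rewrite ij jt in it.
Qed.

Lemma marginal_ge (T : finType) (f : 'I_n -> T) u i :
  (u i <= marginal f (f i) u)%N.
Proof. by rewrite /marginal (bigD1 i) //= leq_addr. Qed.

Lemma marginal_gt0 (T : finType) (f : 'I_n -> T) t u :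
  (0 < marginal f t u)%N -> exists2 i, f i = t & (0 < u i)%N.
Proof.
rewrite lt0n sum_nat_eq0 negb_forall => /existsP[i].
by rewrite negb_imply -lt0n => /andP[/eqP]; exists i.
Qed.

Lemma mdeg_marginal (T : finType) (f : 'I_n -> T) u :
  mdeg u = (\sum_t marginal f t u)%N.
Proof. by rewrite mdegE (partition_big f predT). Qed.

Lemma same_marginals_mdeg u v : same_marginals u v -> mdeg u = mdeg v.
Proof.
by case=> Hh _; rewrite !(mdeg_marginal h); apply: eq_bigr => t _; apply: Hh.
Qed.

Lemma same_marginalsB u v u1 v1 : (u1 <= u)%MM -> (v1 <= v)%MM ->
  same_marginals u v -> same_marginals u1 v1 ->
  same_marginals (u - u1)%MM (v - v1)%MM.
Proof.
move=> uu vv [Hh Hg] [Hh1 Hg1]; split=> t /=.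
  have := Hh t; have := Hh1 t => /=.
  by rewrite -{1}(submK uu) -{1}(submK vv) !marginalD; lia.
have := Hg t; have := Hg1 t => /=.
by rewrite -{1}(submK uu) -{1}(submK vv) !marginalD; lia.
Qed.

Lemma mnm_gt0 u : u != 0%MM -> exists i, (0 < u i)%N.
Proof.
rewrite -mdeg_eq0 mdegE sum_nat_eq0 negb_forall => /existsP[i].
by rewrite -lt0n; exists i.
Qed.

Lemma lem_mdeg_eq u v : (u <= v)%MM -> mdeg u = mdeg v -> u = v.
Proof.
move=> uv e; have := submK uv => vE.
have /eqP: (mdeg (v - u)%MM = 0)%N by move: e; rewrite -{1}vE mdegD; lia.
by rewrite mdeg_eq0 => /eqP w0; rewrite -vE w0 add0m.
Qed.

(** The exponent of the product of the variables with index [f t], for [t] in [S]. *)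
Definition count_mnm (T : finType) (S : {set T}) (f : T -> 'I_n) : 'X_{1..n} :=
  [multinom (\sum_(t in S) (f t == i))%N | i < n].

Lemma marginal_count (T T' : finType) (f : 'I_n -> T) t (S : {set T'}) k :
  marginal f t (count_mnm S k) = (\sum_(s in S) (f (k s) == t))%N.
Proof.
rewrite /marginal; under eq_bigr => i _ do rewrite mnmE.
rewrite exchange_big /=; apply: eq_bigr => s _.
rewrite -(marginalU f t (k s)) /marginal; apply: eq_bigr => i _.
by rewrite mnm1E.
Qed.

Lemma sum_eq_inj (T T' : finType) (S : {set T}) (f : T -> T') t :
  {in S &, injective f} -> (\sum_(s in S) (f s == t))%N = (t \in f @: S).
Proof.
move=> inj; case: imsetP => [[s sS ->]|N].
  rewrite (bigD1 s) //= eqxx big1 // => s' /andP[s'S ne].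
  by case: eqP => // /inj e; rewrite e ?eqxx in ne.
rewrite big1 // => s sS; case: eqP => // e; case: N; by exists s.
Qed.

(* From a class of [h] go to the class reached by following a point of [v] and
   then a point of [u] in the same class of [g]; a minimal invariant set of
   classes is permuted by this map. *)
Lemma exists_thin_subpair u v : same_marginals u v -> u != 0%MM ->
  exists u1 v1, [/\ (u1 <= u)%MM, (v1 <= v)%MM, same_marginals u1 v1,
    u1 != 0%MM & forall t, (marginal h t u1 <= 1)%N].
Proof.
move=> [Hh Hg] /mnm_gt0[i0 ui0].
(* [q a] is a point of [v] in the class [a] of [h], and [p b] a point of [u] in the class [b] of
   [g]; the default [i0] is taken only for classes without such a point. *)
pose q a := odflt i0 [pick i | (h i == a) && (0 < v i)%N].
pose p b := odflt i0 [pick i | (g i == b) && (0 < u i)%N].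
have qP a : (0 < marginal h a v)%N -> h (q a) = a /\ (0 < v (q a))%N.
  move=> /marginal_gt0[i ia vi]; rewrite /q; case: pickP => [j /andP[/eqP]|/(_ i)] //=.
  by rewrite ia eqxx vi.
have pP b : (0 < marginal g b u)%N -> g (p b) = b /\ (0 < u (p b))%N.
  move=> /marginal_gt0[i ia vi]; rewrite /p; case: pickP => [j /andP[/eqP]|/(_ i)] //=.
  by rewrite ia eqxx vi.
pose R := [set a | (0 < marginal h a v)%N]; pose r a := p (g (q a)).
have rP a : a \in R -> g (r a) = g (q a) /\ (0 < u (r a))%N.
  rewrite inE => /qP[_ vq]; apply: pP; rewrite (Hg (g (q a))).
  exact: leq_trans vq (marginal_ge _ _ _).
have inR i : (0 < u i)%N -> h i \in R.
  by move=> ui; rewrite inE -(Hh (h i)); apply: leq_trans ui (marginal_ge _ _ _).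
pose f a := h (r a).
pose inv (S : {set A}) := [&& S != set0, S \subset R & f @: S \subset S].
have invR : inv R.
  apply/and3P; split=> //; first by apply/set0Pn; exists (h i0); apply: inR.
  by apply/subsetP => _ /imsetP[a aR ->]; apply: inR; case: (rP a aR).
have [S /minsetP[/and3P[S0 SR fS] Smin] _] := minset_exists invR.
(* The image of [S] is again invariant, hence all of [S] by minimality. So [f] permutes [S], and
   each class in [S] contains exactly one [r a]: this is thinness. *)
have fSE : f @: S = S.
  apply: (Smin _ _ fS); apply/and3P; split; last exact: imsetS.
    by case/set0Pn: S0 => a aS; apply/set0Pn; exists (f a); apply: imset_f.
  exact: subset_trans fS SR.
have injf : {in S &, injective f} by apply/imset_injP; rewrite fSE.
have qS a : a \in S -> h (q a) = a /\ (0 < v (q a))%N.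
  by move/(subsetP SR); rewrite inE; apply: qP.
have rS a : a \in S -> g (r a) = g (q a) /\ (0 < u (r a))%N.
  by move/(subsetP SR); apply: rP.
have injr : {in S &, injective r}.
  by move=> a b aS bS e; apply: injf => //; rewrite /f e.
have injq : {in S &, injective q}.
  by move=> a b aS bS e; rewrite -(qS a aS).1 -(qS b bS).1 e.
exists (count_mnm S r), (count_mnm S q).
have mu t : marginal h t (count_mnm S r) = (t \in S).
  by rewrite marginal_count -{2}fSE -sum_eq_inj.
split.
- apply/mnm_lepP=> i; rewrite mnmE sum_eq_inj //; case: imsetP => //= -[a aS ->].
  by case: (rS a aS).
- apply/mnm_lepP=> i; rewrite mnmE sum_eq_inj //; case: imsetP => //= -[a aS ->].
  by case: (qS a aS).
- split=> t /=.
    rewrite mu marginal_count -[S in LHS]imset_id -sum_eq_inj //.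
    by apply: eq_bigr => a /qS[->].
  by rewrite !marginal_count; apply: eq_bigr => a /rS[->].
- case/set0Pn: S0 => a aS; apply/eqP => e; have := mu a; rewrite e aS.
  by rewrite /marginal big1 // => i _; rewrite mnm0E.
- by move=> t; rewrite mu leq_b1.
Qed.

(** * Congruence of monomials with equal marginals, from an exchange property *)

Variable sim : 'X_{1..n} -> 'X_{1..n} -> Prop.
Hypothesis sim_refl : forall u, sim u u.
Hypothesis sim_trans : forall v u w, sim u v -> sim v w -> sim u w.
Hypothesis sim_add : forall w u v, sim u v -> sim (u + w)%MM (v + w)%MM.

Lemma simD u v u' v' : sim u v -> sim u' v' -> sim (u + u')%MM (v + v')%MM.
Proof.
move=> uv uv'; apply: (sim_trans (sim_add u' uv)).
by rewrite !(addmC v); apply: sim_add.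
Qed.

(** The points are the corners of an inner rectangle with horizontal sides [p q] and [a b], and the
    last condition is its inner minor. Since the class of [a] already meets [u], replacing [p] by
    [a] in [u] destroys thinness. *)
Definition has_exchange u v : Prop :=
  exists p q a b, [/\ (0 < u p)%N /\ (0 < v q)%N,
    h p = h q /\ h a = h b, g p = g a /\ g q = g b,
    h p <> h a /\ (0 < marginal h (h a) u)%N
    & sim (U_(p) + U_(b))%MM (U_(a) + U_(q))%MM].

(** The geometric input of the induction; [simple_exchange] provides it for simple polyominoes. *)
Hypothesis thin_exchange : forall u v, same_marginals u v -> u != 0%MM ->
  (forall t, (marginal h t u <= 1)%N) ->
  (forall i, (u i == 0)%N || (v i == 0)%N) -> has_exchange u v.

(** The factors [u1] and [u / u1] both have smaller degree, so induction applies to each, and the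
    two congruences multiply. *)
Lemma sim_split d u v u1 v1 :
  (forall u v, (mdeg u < d)%N -> same_marginals u v -> sim u v) ->
  mdeg u = d -> (u1 <= u)%MM -> (v1 <= v)%MM ->
  same_marginals u v -> same_marginals u1 v1 -> u1 != 0%MM -> u1 != u ->
  sim u v.
Proof.
move=> IH du uu vv H H1 u10 u1u; rewrite -(submK uu) -(submK vv).
have e := submK uu; have de : (mdeg (u - u1)%MM + mdeg u1 = d)%N by rewrite -mdegD e.
have d1 : (mdeg u1 != 0)%N by rewrite mdeg_eq0.
apply: simD; apply: IH => //; [lia | exact: same_marginalsB | ].
suff : mdeg u1 <> d by lia.
by move=> e1; case/eqP: u1u; apply: lem_mdeg_eq; rewrite // du.
Qed.

Lemma sim_exchange d u v p q a b A1 B1 A2 B2 :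
  (forall u v, (mdeg u < d)%N -> same_marginals u v -> sim u v) ->
  mdeg u = d -> same_marginals u v -> (0 < u p)%N -> (0 < v q)%N ->
  sim (U_(p) + U_(b))%MM (U_(a) + U_(q))%MM ->
  (A1 + A2 = u - U_(p) + U_(a))%MM -> (B1 + B2 = v - U_(q) + U_(b))%MM ->
  same_marginals A1 B1 -> same_marginals A2 B2 ->
  (mdeg A1 < d)%N -> (mdeg A2 < d)%N -> (0 < A1 a)%N -> sim u v.
Proof.
move=> IH du uv up vq e /mnmP EA /mnmP EB H1 H2 d1 d2 A1a.
have leU (m : 'X_{1..n}) j i : (0 < m j)%N -> ((j == i) <= m i)%N.
  by case: eqP => // <-.
have Aa i := leU _ _ i A1a; have Up i := leU _ _ i up; have Vq i := leU _ _ i vq.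
have S1 := IH _ _ d1 H1; have S2 := IH _ _ d2 H2.
(* If [b] does not divide [B2], then [A2] divides [u] because [a] was used by [A1], and [B2] divides
   [v]: the pair [A2], [B2] splits [u] and [v]. *)
case: (posnP (B2 b)) => [B2b|B2b].
  have A20 : A2 != 0%MM.
    apply/eqP => A20; have := same_marginals_mdeg uv; rewrite du => dv.
    have: (mdeg A1 + mdeg A2 = mdeg u)%N.
      have eu : (A1 + A2 + U_(p) = u + U_(a))%MM.
        by apply/mnmP=> i; move: (EA i) (Up i); rewrite !mnmDE mnmBE !mnm1E; lia.
      by have := congr1 mdeg eu; rewrite !mdegD !mdeg1; lia.
    by rewrite A20 mdeg0; lia.
  apply: (@sim_split d u v A2 B2) => //; last by apply/eqP => E; rewrite -E in du; lia.
    apply/mnm_lepP=> i; move: (EA i) (Aa i).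
    by rewrite !mnmDE mnmBE !mnm1E; lia.
  apply/mnm_lepP=> i; have := EB i; rewrite !mnmDE mnmBE !mnm1E.
  by case: (b =P i) => [<-|] /=; lia.
have Bb i := leU _ _ i B2b.
(* Otherwise, written multiplicatively, [u = (A1/a) p A2 ~ (A1/a) p B2 = p b (A1/a) (B2/b) ~ a q
   (A1/a) (B2/b) = A1 q (B2/b) ~ B1 q (B2/b) = v]. *)
have -> : (u = (A1 - U_(a)) + U_(p) + A2)%MM.
  apply/mnmP=> i; move: (EA i) (Aa i) (Up i).
  by rewrite !(mnmDE,mnmBE,mnm1E); lia.
apply: (sim_trans (simD (sim_refl _) S2)).
have -> : ((A1 - U_(a)) + U_(p) + B2 = (U_(p) + U_(b)) + ((A1 - U_(a)) + (B2 - U_(b))))%MM.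
  by apply/mnmP=> i; move: (Bb i); rewrite !(mnmDE,mnmBE,mnm1E); lia.
apply: (sim_trans (sim_add _ e)).
have -> : (U_(a) + U_(q) + ((A1 - U_(a)) + (B2 - U_(b))) = A1 + (U_(q) + (B2 - U_(b))))%MM.
  by apply/mnmP=> i; move: (Aa i); rewrite !(mnmDE,mnmBE,mnm1E); lia.
apply: (sim_trans (sim_add _ S1)).
suff -> : (B1 + (U_(q) + (B2 - U_(b))) = v)%MM by [].
apply/mnmP=> i; move: (EB i) (Bb i) (Vq i).
by rewrite !(mnmDE,mnmBE,mnm1E); lia.
Qed.

Lemma sim_same_marginals u v : same_marginals u v -> sim u v.
Proof.
move: {2}(mdeg u).+1 (ltnSn (mdeg u)) => d; elim: d u v => // d IH0 u v du uv.
have {}IH0 u' v' : (mdeg u' < mdeg u)%N -> same_marginals u' v' -> sim u' v'.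
  by move=> ?; apply: IH0; lia.
have dv := same_marginals_mdeg uv.
case: (eqVneq u 0%MM) => [u0|u0].
  suff -> : v = u by exact: sim_refl.
  by rewrite u0; apply/eqP; rewrite -mdeg_eq0 -dv u0 mdeg0.
have [u1 [v1 [uu vv uv1 u10 thin]]] := exists_thin_subpair uv u0.
case: (eqVneq u1 u) => [eu|ne]; last exact: (@sim_split (mdeg u) u v u1 v1).
rewrite {u1}eu in uu uv1 u10 thin.
(* A common variable is itself a proper matching part, unless it is the whole of [u]. *)
case: (boolP [exists i, (0 < u i)%N && (0 < v i)%N]) => [/existsP[i /andP[ui vi]]|].
  have iu : (U_(i) <= u)%MM by rewrite lep1mP; lia.
  have iv : (U_(i) <= v)%MM by rewrite lep1mP; lia.
  case: (eqVneq (U_(i))%MM u) => [e|ne].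
    suff -> : v = u by apply: sim_refl.
    by rewrite -e; symmetry; apply: lem_mdeg_eq; rewrite // e.
  by apply: (@sim_split (mdeg u) u v _ _ _ _ iu iv) => //; rewrite mnm1_eq0.
rewrite negb_exists => /forallP disj.
have [|p [q [a [b [[up vq] [hpq hab] [gpa gqb] [hpa La] e]]]]] :=
  thin_exchange uv u0 thin; first by move=> i; have := disj i; lia.
have [u' u'E] : exists u', u' = (u - U_(p) + U_(a))%MM by eexists.
have [v' v'E] : exists v', v' = (v - U_(q) + U_(b))%MM by eexists.
have Up : (U_(p) <= u)%MM by rewrite lep1mP; lia.
have Vq : (U_(q) <= v)%MM by rewrite lep1mP; lia.
have mU (T : finType) (f : 'I_n -> T) t :
  (marginal f t u' + (f p == t) = marginal f t u + (f a == t))%N.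
  by rewrite -!marginalU -!marginalD u'E -addmA (addmC (U_(a))%MM) addmA submK.
have mV (T : finType) (f : 'I_n -> T) t :
  (marginal f t v' + (f q == t) = marginal f t v + (f b == t))%N.
  by rewrite -!marginalU -!marginalD v'E -addmA (addmC (U_(b))%MM) addmA submK.
have uv' : same_marginals u' v'.
  case: uv => Hh Hg; split=> t /=.
    by have := mU _ h t; have := mV _ h t; rewrite hpq hab (Hh t); lia.
  by have := mU _ g t; have := mV _ g t; rewrite gpa gqb (Hg t); lia.
have du' : mdeg u' = mdeg u.
  have := congr1 mdeg (submK Up); rewrite u'E !mdegD !mdeg1; lia.
have u'0 : u' != 0%MM by rewrite -mdeg_eq0 du' mdeg_eq0.
have [A1 [B1 [uA vB AB A0 thinA]]] := exists_thin_subpair uv' u'0.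
(* The class of [a] has degree at least 2 in [u']: it contains [a] and a point of [u], and it does
   not contain [p]. A thin part of [u'] is therefore proper. *)
have Au : A1 != u'.
  apply/eqP => E; have := mU _ h (h a); have := thinA (h a).
  by rewrite E eqxx; case: eqP => // _; clear -La; lia.
have AB2 := same_marginalsB uA vB uv' AB.
have EA := submK uA; have EB := submK vB.
have dA : (mdeg (u' - A1)%MM + mdeg A1 = mdeg u)%N by rewrite -mdegD EA.
have dA1 : (mdeg A1 != 0)%N by rewrite mdeg_eq0.
have dA2 : mdeg A1 <> mdeg u.
  by move=> E; case/eqP: Au; apply: lem_mdeg_eq; rewrite // du'.
have ltA1 : (mdeg A1 < mdeg u)%N by clear -dA dA2; lia.
have ltA2 : (mdeg (u' - A1)%MM < mdeg u)%N by clear -dA dA1; lia.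
have EA' : (A1 + (u' - A1) = u - U_(p) + U_(a))%MM by rewrite addmC EA.
have EB' : (B1 + (v' - B1) = v - U_(q) + U_(b))%MM by rewrite addmC EB.
(* Either [A1] or its cofactor contains [a], and the two play symmetric roles. *)
case: (posnP (A1 a)) => [Aa|Aa]; last first.
  exact: (sim_exchange IH0 _ uv up vq e EA' EB' AB AB2 ltA1 ltA2 Aa).
rewrite addmC in EA'; rewrite addmC in EB'.
apply: (sim_exchange IH0 _ uv up vq e EA' EB' AB2 AB ltA2 ltA1) => //.
have := congr1 (fun m : 'X_{1..n} => m a) EA'; clear -Aa.
by rewrite !(mnmDE,mnmBE,mnm1E) eqxx; lia.
Qed.

End Balanced.

(** * Edge intervals *)

Lemma pointE (a b : point) : (a == b) = (a.1 == b.1) && (a.2 == b.2).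
Proof. by []. Qed.

Lemma hedge_inj : injective hedge.
Proof.
move=> [a1 a2] [b1 b2] /fsetP H; move: (H (a1, a2)) (H (b1, b2)) (H (a1 + 1, a2)).
by rewrite !inE !xpair_eqE /= => *; congr pair; lia.
Qed.

Lemma vedge_inj : injective vedge.
Proof.
move=> [a1 a2] [b1 b2] /fsetP H; move: (H (a1, a2)) (H (b1, b2)) (H (a1, a2 + 1)).
by rewrite !inE !xpair_eqE /= => *; congr pair; lia.
Qed.

Lemma hedge_neq_vedge a b : hedge a <> vedge b.
Proof.
move: a b => [a1 a2] [b1 b2] /fsetP H; move: (H (a1, a2)) (H (a1 + 1, a2)).
by rewrite !inE !xpair_eqE /=; lia.
Qed.

(* [d = false] is the horizontal direction, [d = true] the vertical one. *)
Definition coord (d : bool) (z : point) : int := if d then z.2 else z.1.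

Definition mkpoint (d : bool) (t c : int) : point := if d then (c, t) else (t, c).

Definition direction (d : bool) : point := mkpoint d 1 0.

Definition unit_edge (d : bool) (a : point) : {fset point} :=
  if d then vedge a else hedge a.

(** A boolean form of [edge_of]: the two cells are those on either side of the unit edge that starts
    at [a]. *)
Definition is_edge (P : {fset cell}) (d : bool) (a : point) : bool :=
  (a \in P) || (a - direction (~~ d) \in P).

Definition edge_interval (P : {fset cell}) (d : bool) : point -> point -> Prop :=
  if d then vedge_interval P else hedge_interval P.

Lemma edge_ofP P d a : edge_of P (unit_edge d a) <-> is_edge P d a.
Proof.
rewrite /is_edge; split.
  case=> C CP; case: d => /=; rewrite !inE => /or4P[] /eqP.
  - by move/esym/hedge_neq_vedge.
  - by move/vedge_inj => ->; rewrite addrK CP orbT.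
  - by move/esym/hedge_neq_vedge.
  - by move/vedge_inj => ->; rewrite CP.
  - by move/hedge_inj => ->; rewrite CP.
  - by move/hedge_neq_vedge.
  - by move/hedge_inj => ->; rewrite addrK CP orbT.
  - by move/hedge_neq_vedge.
by case/orP => aP; [exists a | exists (a - direction (~~ d))] => //;
  case: d aP => /= aP; rewrite !inE ?subrK eqxx ?orbT.
Qed.

Lemma edge_intervalP P d a b : edge_interval P d a b <->
  [/\ coord (~~ d) a = coord (~~ d) b, coord d a < coord d b
    & forall t, coord d a <= t < coord d b ->
        is_edge P d (mkpoint d t (coord (~~ d) a))].
Proof.
case: d => /=; split=> -[e l H]; split=> // t /H.
- by move/(edge_ofP P true).
- by move=> ?; apply/(edge_ofP P true).
- by move/(edge_ofP P false).
- by move=> ?; apply/(edge_ofP P false).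
Qed.

Lemma vertexP P z : reflect (exists2 C, C \in P & z \in vertices C)
  (z \in polyomino_vertices P).
Proof.
apply: (iffP (bigfcupP _ _ _ _)) => [[C /andP[CP _]]|[C CP zC]]; first by exists C.
by exists C => //; rewrite CP.
Qed.

Lemma vertex_is_edge P d z : (z \in polyomino_vertices P) =
  is_edge P d z || is_edge P d (z - direction d).
Proof.
apply/vertexP/idP => [[C CP]|].
  rewrite /is_edge !inE -!orbA => /or4P[] /eqP ->; case: d => /=;
  rewrite ?addrK ?CP ?orbT //.
  - by rewrite (_ : C + (1, 1) - direction true - direction false = C) ?CP ?orbT //;
      apply/eqP; rewrite pointE /=; lia.
  - by rewrite (_ : C + (1, 1) - direction false - direction true = C) ?CP ?orbT //;
      apply/eqP; rewrite pointE /=; lia.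
rewrite /is_edge -!orbA => /or4P[] zP; (eexists; first exact: zP); rewrite !inE;
  case: d {zP}; rewrite !pointE /=; lia.
Qed.

Lemma lattice_intervalE d a b z : (z \in lattice_interval a b) =
  (coord d a <= coord d z <= coord d b) &&
  (coord (~~ d) a <= coord (~~ d) z <= coord (~~ d) b).
Proof. by rewrite inE /lep; case: d => /=; lia. Qed.

Lemma mkpointK d z : mkpoint d (coord d z) (coord (~~ d) z) = z.
Proof. by case: z d => ? ? []. Qed.

Lemma coord_mkpoint d t c : coord d (mkpoint d t c) = t.
Proof. by case: d. Qed.

Lemma coordN_mkpoint d t c : coord (~~ d) (mkpoint d t c) = c.
Proof. by case: d. Qed.

Lemma mkpointB d t c : mkpoint d t c - direction d = mkpoint d (t - 1) c.
Proof. by apply/eqP; rewrite pointE; case: d => /=; lia. Qed.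

Lemma fset_points_bounded (P : {fset point}) :
  exists N : nat, forall C : point, C \in P -> (`|C.1| < N)%N /\ (`|C.2| < N)%N.
Proof.
suff: forall s : seq point, exists N : nat,
    forall C : point, C \in s -> (`|C.1| < N)%N /\ (`|C.2| < N)%N by apply.
elim=> [|D s [N H]]; first by exists 0%N.
exists (N + `|D.1| + `|D.2|)%N.+1 => C; rewrite inE => /predU1P[->|/H]; first by lia.
by case; lia.
Qed.

(** With [e t] telling whether the unit step from [t] to [t + 1] is allowed, all steps between [x]
    and [y] are, in whichever order the two come. Enumerating offsets from the smaller end makes
    this boolean. *)
Definition chained (e : int -> bool) (x y : int) : bool :=
  all (fun k : nat => e (Num.min x y + k%:Z)) (iota 0 `|x - y|).

Lemma chainedP (e : int -> bool) (x y : int) :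
  reflect (forall t : int, (x <= t < y) || (y <= t < x) -> e t) (chained e x y).
Proof.
apply: (iffP allP) => H t ht.
  have := H `|t - Num.min x y|%N; rewrite mem_iota.
  have -> : Num.min x y + `|t - Num.min x y|%:Z = t by lia.
  by apply; lia.
by apply: H; move: ht; rewrite mem_iota; lia.
Qed.

(** On vertices of [P] this is membership in a common maximal edge interval, stated as a boolean
    equivalence relation without mention of the interval. *)
Definition link (P : {fset cell}) (d : bool) (a b : point) : bool :=
  (coord (~~ d) a == coord (~~ d) b) &&
  chained (fun t => is_edge P d (mkpoint d t (coord (~~ d) a))) (coord d a) (coord d b).

Lemma link_refl P d : reflexive (link P d).
Proof. by move=> a; rewrite /link eqxx; apply/chainedP=> t; lia. Qed.

Lemma link_sym P d a b : link P d a b = link P d b a.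
Proof.
suff sym x y : link P d x y -> link P d y x by apply/idP/idP; apply: sym.
move=> /andP[/eqP e /chainedP H]; rewrite /link -e eqxx.
by apply/chainedP=> t ht; apply: H; lia.
Qed.

Lemma link_trans P d : transitive (link P d).
Proof.
move=> b a c /andP[/eqP eab /chainedP Hab] /andP[/eqP ebc /chainedP Hbc].
rewrite /link eab ebc eqxx; apply/chainedP=> t ht.
rewrite -ebc in Hbc *; rewrite eab in Hab.
case: (boolP ((coord d a <= t < coord d b) || (coord d b <= t < coord d a))).
  exact: Hab.
by move=> N; apply: Hbc; lia.
Qed.

(** Walk from [x] each way to the first failure of [e], which exists because [e] is bounded. The run
    is empty, [i = k = x], when [e] fails on both sides of [x]. *)
Lemma exists_maximal_run (e : int -> bool) (N : nat) (x : int) :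
  (forall t : int, e t -> - N%:Z <= t <= N%:Z) ->
  exists i k : int, [/\ i <= x <= k, forall t : int, i <= t < k -> e t, ~~ e (i - 1) & ~~ e k].
Proof.
move=> bnd.
have exR : exists m : nat, ~~ e (x + m%:Z).
  by exists (N + `|x|)%N.+1; apply/negP=> /bnd; lia.
have exL : exists m : nat, ~~ e (x - m%:Z - 1).
  by exists (N + `|x|)%N.+1; apply/negP=> /bnd; lia.
case: (ex_minnP exR) => r er rmin; case: (ex_minnP exL) => l el lmin.
exists (x - l%:Z), (x + r%:Z); split=> // [|t ht]; first by lia.
apply/negPn/negP => et; case: (leP x t) => xt.
  have := rmin `|t - x|%N; rewrite (_ : x + `|t - x|%:Z = t); last by lia.
  by move=> /(_ et); lia.
have := lmin (`|x - t|%N.-1); rewrite (_ : x - (`|x - t|%N.-1)%:Z - 1 = t); last by lia.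
by move=> /(_ et); lia.
Qed.

Lemma exists_maximal_interval P d z : z \in polyomino_vertices P ->
  exists a b, maximal_interval (edge_interval P d) a b /\
    forall c, c \in lattice_interval a b = link P d z c.
Proof.
move=> zP; pose c := coord (~~ d) z; pose e t := is_edge P d (mkpoint d t c).
have [N HN] := fset_points_bounded P.
have bnd (t : int) : e t -> - N%:Z <= t <= N%:Z.
  by rewrite /e /is_edge; case: d @c @e => c e /orP[] /HN /=; lia.
have [i [k [/andP[ix xk] H ei ek]]] := exists_maximal_run (coord d z) bnd.
(* At least one of the two unit edges at the vertex [z] in direction [d] is an edge of [P]. *)
have ik : i < k.
  have := zP; rewrite (vertex_is_edge _ d) -{2}(mkpointK d z) mkpointB -{1}(mkpointK d z).
  rewrite -/c -/(e _) -/(e _) => /orP[] ez.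
    have : k <> coord d z by move=> E; rewrite -E (negbTE ek) in ez.
    lia.
  have : i <> coord d z by move=> E; rewrite -E (negbTE ei) in ez.
  lia.
exists (mkpoint d i c), (mkpoint d k c); split.
  split.
    by apply/edge_intervalP; rewrite !coord_mkpoint !coordN_mkpoint; split.
  move=> a b /edge_intervalP[eab ltab Hab] sub y; rewrite !(lattice_intervalE d).
  have := sub (mkpoint d i c); have := sub (mkpoint d k c).
  rewrite !(lattice_intervalE d) !coord_mkpoint !coordN_mkpoint.
  move=> s1 s2 h.
  have cE : coord (~~ d) a = c by lia.
  have n1 : ~ (coord d a <= i - 1 < coord d b).
    by move=> /Hab; rewrite cE; apply/negP.
  have n2 : ~ (coord d a <= k < coord d b).
    by move=> /Hab; rewrite cE; apply/negP.
  lia.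
move=> y; rewrite (lattice_intervalE d) !coord_mkpoint !coordN_mkpoint /link -/c.
apply/andP/andP => [[iyk ccc]|[/eqP cE /chainedP Hz]].
  by split; [lia | apply/chainedP=> t ht; apply: H; lia].
have n1 : ~ ((coord d z <= i - 1 < coord d y) || (coord d y <= i - 1 < coord d z)).
  by move/Hz; apply/negP.
have n2 : ~ ((coord d z <= k < coord d y) || (coord d y <= k < coord d z)).
  by move/Hz; apply/negP.
split; lia.
Qed.

(** An edge of [P] just beyond an end would prolong the interval. *)
Lemma maximal_interval_ends P d a b : maximal_interval (edge_interval P d) a b ->
  ~~ is_edge P d (mkpoint d (coord d a - 1) (coord (~~ d) a)) /\
  ~~ is_edge P d (mkpoint d (coord d b) (coord (~~ d) a)).
Proof.
case=> /edge_intervalP[eab ltab H] max; split; apply/negP => E.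
  have /max sub : edge_interval P d (mkpoint d (coord d a - 1) (coord (~~ d) a)) b.
    apply/edge_intervalP; rewrite !coord_mkpoint !coordN_mkpoint; split=> //; first by lia.
    by move=> t ht; case: (eqVneq t (coord d a - 1)) => [-> //|ne]; apply: H; lia.
  have /sub /(_ (mkpoint d (coord d a - 1) (coord (~~ d) a))) :
      {subset lattice_interval a b <=
        lattice_interval (mkpoint d (coord d a - 1) (coord (~~ d) a)) b}.
    by move=> z; rewrite !(lattice_intervalE d) !coord_mkpoint !coordN_mkpoint; lia.
  by rewrite !(lattice_intervalE d) !coord_mkpoint !coordN_mkpoint; lia.
have /max sub : edge_interval P d a (mkpoint d (coord d b + 1) (coord (~~ d) a)).
  apply/edge_intervalP; rewrite !coord_mkpoint !coordN_mkpoint; split=> //; first by lia.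
  by move=> t ht; case: (eqVneq t (coord d b)) => [-> //|ne]; apply: H; lia.
have /sub /(_ (mkpoint d (coord d b + 1) (coord (~~ d) a))) :
    {subset lattice_interval a b <=
      lattice_interval a (mkpoint d (coord d b + 1) (coord (~~ d) a))}.
  by move=> z; rewrite !(lattice_intervalE d) !coord_mkpoint !coordN_mkpoint; lia.
by rewrite !(lattice_intervalE d) !coord_mkpoint !coordN_mkpoint; lia.
Qed.

Lemma admissible_link P (alpha : polyomino_vertices P -> int) d
    (v : polyomino_vertices P) : admissible alpha ->
  \sum_(w : polyomino_vertices P | link P d (val v) (val w)) alpha w = 0.
Proof.
move=> adm; have [a [b [max E]]] := exists_maximal_interval d (valP v).
under eq_bigl => w do rewrite -E.
by apply: adm; case: d max {E}; [right | left].
Qed.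

(** * The potential of a labeling *)

Lemma link_coordN P d a b : link P d a b -> coord (~~ d) a = coord (~~ d) b.
Proof. by case/andP=> /eqP. Qed.

Lemma link_edge P d a b (t : int) : link P d a b -> coord d a <= t < coord d b ->
  is_edge P d (mkpoint d t (coord (~~ d) a)).
Proof. by case/andP=> _ /chainedP H ht; apply: H; rewrite ht. Qed.

Lemma link_between P d a b z : link P d a b -> coord (~~ d) z = coord (~~ d) a ->
  coord d a <= coord d z <= coord d b -> link P d a z.
Proof.
case/andP=> _ /chainedP H ez hz; rewrite /link ez eqxx.
by apply/chainedP=> t ht; apply: H; lia.
Qed.

Lemma cell_inP (a b C : point) :
  cell_in a b C <-> [/\ a.1 <= C.1, C.1 < b.1, a.2 <= C.2 & C.2 < b.2].
Proof.
split=> [H|[h1 h2 h3 h4] z].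
  have /H h1 : C \in vertices C by rewrite !inE eqxx.
  have /H : C + (1, 1) \in vertices C by rewrite !inE eqxx !orbT.
  by move: h1; rewrite !inE /lep /=; split; lia.
by rewrite !inE -!orbA /lep => /or4P[] /eqP -> /=; lia.
Qed.

Lemma unit_edge_inj d d' a b : unit_edge d a = unit_edge d' b -> d = d' /\ a = b.
Proof.
case: d d' => [] [] /=; [by move/vedge_inj | | | by move/hedge_inj].
  by move/esym/hedge_neq_vedge.
by move/hedge_neq_vedge.
Qed.

Lemma cell_adjP C D : cell_adj C D ->
  C = D \/ exists d, C = D + direction d \/ D = C + direction d.
Proof.
have mem E (e : {fset point}) : e \in edges E -> exists d,
    e = unit_edge d E \/ e = unit_edge d (E + direction (~~ d)).
  by rewrite !inE => /or4P[] /eqP ->;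
    [exists false; left | exists true; right | exists false; right | exists true; left].
case/andP=> /mem[d]; set e := _ `&` _ => hC /mem[d' hD].
case: hC hD => -> [] /unit_edge_inj[dd H]; rewrite -?dd in H.
- by left; exact: H.
- by right; exists (~~ d); left.
- by right; exists (~~ d); right.
- by left; apply: addIr H.
Qed.

Lemma vertex_nonneg (P : {fset cell}) z : {in P, forall C, lep 0 C} ->
  z \in polyomino_vertices P -> lep 0 z.
Proof.
move=> P0 /vertexP[D /P0]; rewrite !inE -!orbA /lep => D0 /or4P[] /eqP -> /=.
all: by move: D0; rewrite /=; lia.
Qed.

Section Potential.
Variable P : {fset cell}.
Local Notation n := #|{: polyomino_vertices P}|.

Definition pt (i : 'I_n) : point := val (enum_val i).

(** Encoding a class of [link] as a set of indices puts the maximal intervals in a finite type, as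
    [marginal] requires. *)
Definition line_class (d : bool) (i : 'I_n) : {set 'I_n} :=
  [set j | link P d (pt i) (pt j)].

Lemma line_classP d i j :
  reflect (line_class d i = line_class d j) (link P d (pt i) (pt j)).
Proof.
apply: (iffP idP) => [ij|E].
  apply/setP=> k; rewrite !inE; apply/idP/idP; apply: link_trans => //.
  by rewrite link_sym.
have : j \in line_class d j by rewrite inE link_refl.
by rewrite -E inE.
Qed.

Lemma pt_inj : injective pt.
Proof. by move=> i j /val_inj /enum_val_inj. Qed.

Lemma pt_surj z : z \in polyomino_vertices P -> exists i, pt i = z.
Proof. by move=> zP; exists (enum_rank [` zP]); rewrite /pt enum_rankK. Qed.

Lemma pt_vertex i : pt i \in polyomino_vertices P.
Proof. exact: valP. Qed.

Variable alpha : 'I_n -> int.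
Hypothesis alpha0 : forall d t, \sum_(i | line_class d i == t) alpha i = 0.

(** Such a [Q] is a union of maximal intervals, and [alpha] sums to 0 over each of them. *)
Lemma invariant_sum0 d (Q : pred 'I_n) :
  (forall i j, link P d (pt i) (pt j) -> Q i = Q j) -> \sum_(i | Q i) alpha i = 0.
Proof.
move=> inv; rewrite (partition_big (line_class d) predT) //= big1 // => t _.
case: (pickP [pred i | Q i && (line_class d i == t)]) => [i /andP[Qi /eqP it]|N].
  rewrite -[RHS](alpha0 d t); apply: eq_bigl => j.
  rewrite andb_idl // => /eqP jt; rewrite -(inv i) //.
  by apply/line_classP; rewrite it.
by rewrite big_pred0.
Qed.

Definition potential (z : point) : int :=
  \sum_(i | ((pt i).1 <= z.1) && (z.2 < (pt i).2)) alpha i.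

Lemma potential_below z : potential (z - (0, 1)) - potential z =
  \sum_(i | ((pt i).1 <= z.1) && ((pt i).2 == z.2)) alpha i.
Proof.
rewrite /potential (bigID [pred i | z.2 < (pt i).2]) /= addrAC -[RHS]add0r.
congr (_ + _); last by apply: eq_bigl => i; lia.
by apply/eqP; rewrite subr_eq0; apply/eqP/eq_bigl => i; lia.
Qed.

Lemma potential_left z : potential z - potential (z - (1, 0)) =
  \sum_(i | ((pt i).1 == z.1) && (z.2 < (pt i).2)) alpha i.
Proof.
rewrite /potential (bigID [pred i | (pt i).1 <= z.1 - 1]) /= addrAC -[RHS]add0r.
congr (_ + _); last by apply: eq_bigl => i; lia.
by apply/eqP; rewrite subr_eq0; apply/eqP/eq_bigl => i; lia.
Qed.

Lemma not_edge_separates d z a b : ~~ is_edge P d z -> link P d a b ->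
  coord (~~ d) a = coord (~~ d) z -> (coord d a <= coord d z) = (coord d b <= coord d z).
Proof.
move=> ez ab az; apply/idP/idP => h; rewrite leNgt; apply/negP => lt;
  case/negP: ez; rewrite -(mkpointK d z) -az.
  by apply: (link_edge ab); rewrite h.
by rewrite (link_coordN ab); apply: (@link_edge _ _ _ a); rewrite ?h // link_sym.
Qed.

(** Up to sign the difference is the sum over a ray along the line of the missing edge, with one end
    at that edge. No maximal interval crosses the edge, so the ray is a union of maximal
    intervals. *)
Lemma potential_edge d z : ~~ is_edge P d z ->
  potential z = potential (z - direction (~~ d)).
Proof.
move=> ez; apply/eqP; rewrite -subr_eq0; case: d ez => ez.
  rewrite potential_left (@invariant_sum0 true) // => i j ij.
  have := not_edge_separates ez ij; have := link_coordN ij; rewrite /=; lia.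
rewrite -oppr_eq0 opprB potential_below (@invariant_sum0 false) // => i j ij.
have := not_edge_separates ez ij; have := link_coordN ij; rewrite /=; lia.
Qed.

Lemma potential_adj C D : C \notin P -> D \notin P -> cell_adj C D ->
  potential C = potential D.
Proof.
move=> CP DP /cell_adjP[-> //|[d [] E]].
  rewrite (@potential_edge (~~ d)); first by rewrite E negbK addrK.
  by rewrite /is_edge negb_or CP negbK E addrK.
rewrite [RHS](@potential_edge (~~ d)); first by rewrite E negbK addrK.
by rewrite /is_edge negb_or DP negbK E addrK.
Qed.

(** To the left of the rectangle or above it the sum is empty; to the right or below, the quadrant
    cuts the vertices in whole horizontal or vertical intervals. *)
Lemma potential_outside (a b C : point) :
  (forall D, D \in P -> cell_in a b D) -> ~ cell_in a b C -> potential C = 0.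
Proof.
move=> PI CI.
have ptI i : lep a (pt i) && lep (pt i) b.
  have /vertexP[D DP iD] := pt_vertex i.
  exact: PI DP _ iD.
case: (leP a.1 C.1) => a1; last first.
  by rewrite /potential big_pred0 // => i; have := ptI i; rewrite /lep; lia.
case: (leP b.1 C.1) => b1.
  apply: (@invariant_sum0 false) => i j ij; have := link_coordN ij => /=.
  by have := ptI i; have := ptI j; rewrite /lep; lia.
case: (leP b.2 C.2) => b2.
  by rewrite /potential big_pred0 // => i; have := ptI i; rewrite /lep; lia.
case: (leP a.2 C.2) => a2; last first.
  apply: (@invariant_sum0 true) => i j ij; have := link_coordN ij => /=.
  by have := ptI i; have := ptI j; rewrite /lep; lia.
by case: CI; apply/cell_inP.
Qed.

Lemma potential_simple C : simple_polyomino P -> C \notin P -> potential C = 0.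
Proof.
case=> I [[_ [a [b ab]]] /fsubsetP PI esc] /esc[s [_ pth sP lastI]].
have PI' D : D \in P -> cell_in a b D by move=> /PI /ab.
have -> : potential C = potential (last C s).
  elim: s C pth sP {lastI} => //= D s IH C /andP[CD pth] sP.
  rewrite -IH //; last by move=> E Es; apply: sP; rewrite inE Es orbT.
  by apply: potential_adj => //; apply: sP; rewrite !inE eqxx ?orbT.
by apply: potential_outside PI' _ => /ab; apply/negP.
Qed.

(** Every other maximal interval on this line lies wholly on one side of [z], so it contributes
    0. *)
Lemma partial_line_sum d c z : is_edge P d z -> link P d c z ->
  \sum_(i | (coord d (pt i) <= coord d z) && (coord (~~ d) (pt i) == coord (~~ d) z))
    alpha i =
  \sum_(i | link P d c (pt i) && (coord d (pt i) <= coord d z)) alpha i.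
Proof.
move=> ez cz; rewrite (bigID [pred i | link P d c (pt i)]) /=.
rewrite [X in _ + X](@invariant_sum0 d) ?addr0.
  apply: eq_bigl => i; case: (boolP (link _ _ c _)) => ci; rewrite ?andbF // andbT.
  by rewrite andbC -(link_coordN ci) (link_coordN cz) eqxx.
have main i j : link P d (pt i) (pt j) ->
    [&& coord d (pt i) <= coord d z, coord (~~ d) (pt i) == coord (~~ d) z
      & ~~ link P d c (pt i)] ->
    [&& coord d (pt j) <= coord d z, coord (~~ d) (pt j) == coord (~~ d) z
      & ~~ link P d c (pt j)].
  move=> ij /and3P[h1 h2 h3]; rewrite -(link_coordN ij) h2 /=.
  apply/andP; split.
    rewrite leNgt; apply: contra h3 => h4; apply: (link_trans cz).
    by rewrite link_sym; apply: (link_between ij); [rewrite (eqP h2) | rewrite h1 ltW].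
  by apply: contra h3 => cj; apply: (link_trans cj); rewrite link_sym.
move=> i j ij; rewrite -!andbA; apply/idP/idP; apply: main => //.
by rewrite link_sym.
Qed.

End Potential.

(** * Simple polyominoes are balanced *)

Section Rectangle.
Variable P : {fset cell}.
Local Notation n := #|{: polyomino_vertices P}|.
Variable alpha : 'I_n -> int.
Hypothesis alpha0 : forall d t, \sum_(i | line_class d i == t) alpha i = 0.
Hypothesis P_nonneg : {in P, forall C, lep 0 C}.
Hypothesis P_simple : simple_polyomino P.

Lemma pt_nonneg (i : 'I_n) : lep 0 (pt i).
Proof. exact: vertex_nonneg P_nonneg (pt_vertex i). Qed.

(* The rectangle hangs from [l] and [r] and extends down as long as the
   potential below the segment from [l] to [r] stays equal to [alpha l]. *)
Lemma exists_inner_rectangle (l r : 'I_n) :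
  link P false (pt l) (pt r) -> (pt l).1 < (pt r).1 -> alpha l <> 0 ->
  (forall i, link P false (pt l) (pt i) -> (pt i).1 < (pt r).1 -> i <> l ->
     alpha i = 0) ->
  (forall i, alpha i <> 0 -> (pt i).2 <= (pt l).2) ->
  exists a b : 'I_n,
    [/\ inner_interval P (pt a) (pt r),
        pt l = ((pt a).1, (pt r).2) /\ pt b = ((pt r).1, (pt a).2),
        link P true (pt l) (pt a) /\ link P true (pt r) (pt b),
        link P false (pt a) (pt b)
      & exists2 i, link P false (pt a) (pt i) & alpha i <> 0].
Proof.
move=> lr lt al alone top.
have ery : (pt r).2 = (pt l).2 by have /= := link_coordN lr.
have [x0 ex0] : exists x, x = (pt l).1 by eexists.
have [x1 ex1] : exists x, x = (pt r).1 by eexists.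
have [y ey] : exists y, y = (pt l).2 by eexists.
(* All labels above height [y] vanish, and in the row at height [y] the interval of [l] contributes
   only [alpha l]. *)
have potT (x : int) : x0 <= x < x1 -> potential alpha (x, y - 1) = alpha l.
  move=> hx; rewrite /potential /= (bigID [pred i | (pt i).2 == y]) /=.
  rewrite [X in _ + X]big1 ?addr0; last first.
    by move=> i hi; apply/eqP/negPn/negP => /eqP /top; lia.
  have ez : is_edge P false (x, y).
    by rewrite ey; apply: (link_edge lr) => /=; rewrite -ex0 -ex1.
  have lz : link P false (pt l) (x, y).
    by apply: (link_between lr) => //=; rewrite -ex0 -ex1; lia.
  transitivity (\sum_(i | link P false (pt l) (pt i) && ((pt i).1 <= x)) alpha i).
    by rewrite -(partial_line_sum alpha0 ez lz); apply: eq_bigl => i /=; lia.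
  rewrite (bigD1 l) ?link_refl /=; last by rewrite -ex0; lia.
  rewrite big1 ?addr0 // => i /andP[/andP[li xi] /eqP il]; apply: alone => //; lia.
pose bad (k : nat) := has (fun j : nat => potential alpha (x0 + j%:Z, y - 1 - k%:Z) != alpha l)
  (iota 0 `|x1 - x0|).
have y0 : 0 <= y by have := pt_nonneg l; rewrite /lep /= -ey; lia.
have exbad : exists k, bad k.
  (* This is the row of cells at height -1, below all vertices, where the potential is a sum over
     whole vertical intervals. *)
  exists `|y|%N; apply/hasP; exists 0%N; first by rewrite mem_iota; lia.
  rewrite addr0 eq_sym; apply/eqP => e; apply: al; rewrite e.
  apply: (@invariant_sum0 _ _ alpha0 true) => i j ij; have := link_coordN ij => /=.
  by have := pt_nonneg i; have := pt_nonneg j; rewrite /lep /=; lia.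
case: (ex_minnP exbad) => k badk kmin.
have pot (x t : int) : x0 <= x < x1 -> y - k%:Z <= t < y -> potential alpha (x, t) = alpha l.
  move=> hx ht; apply/eqP/negPn/negP => ne.
  have : bad (`|y - t|%N.-1).
    apply/hasP; exists `|x - x0|%N; first by rewrite mem_iota; lia.
    rewrite (_ : x0 + _ = x); last by lia.
    by rewrite (_ : y - 1 - _ = t) //; lia.
  by move/kmin; lia.
have kpos : (0 < k)%N.
  case: (posnP k) badk => // -> /hasP[j]; rewrite mem_iota => hj.
  by rewrite subr0 potT ?eqxx //; lia.
have inP (x t : int) : x0 <= x < x1 -> y - k%:Z <= t < y -> (x, t) \in P.
  move=> hx ht; apply/negPn/negP => NP; apply: al.
  by rewrite -(pot x t hx ht); apply: potential_simple.
have [a ea] : exists a : 'I_n, pt a = (x0, y - k%:Z).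
  apply: pt_surj; apply/vertexP; exists (x0, y - k%:Z); first by apply: inP; lia.
  by rewrite !inE eqxx.
have [b eb] : exists b : 'I_n, pt b = (x1, y - k%:Z).
  apply: pt_surj; apply/vertexP; exists (x1 - 1, y - k%:Z); first by apply: inP; lia.
  by rewrite !inE !pointE /=; lia.
have lab : link P false (pt a) (pt b).
  rewrite ea eb /link /= eqxx; apply/chainedP=> t ht; rewrite /is_edge inP //; lia.
exists a, b; split => //.
- rewrite ea; split=> /=; [lia | lia | move=> [c1 c2] /cell_inP[/= h1 h2 h3 h4]].
  by apply: inP; lia.
- by rewrite ea eb /= ex0 ex1 ery; split=> //; case: (pt l).
- rewrite ea eb /link /= -ex0 -ex1 !eqxx -ey ery -ey; split; apply/chainedP=> t ht.
    by rewrite /is_edge inP //; lia.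
  rewrite /is_edge (_ : _ - _ = (x1 - 1, t)); last by apply/eqP; rewrite pointE /=; lia.
  by rewrite (inP (x1 - 1)) ?orbT //; lia.
case/hasP: badk => j; rewrite mem_iota => hj ne.
have hz : x0 <= x0 + j%:Z < x1 by lia.
have hk : y - k%:Z <= y - k%:Z < y by lia.
have zP := inP _ _ hz hk.
have ez : is_edge P false (x0 + j%:Z, y - k%:Z) by rewrite /is_edge zP.
have az : link P false (pt a) (x0 + j%:Z, y - k%:Z).
  by apply: (link_between lab); rewrite ea ?eb //=; lia.
(* Across the lower side the potential changes at this bad cell, and the change is a partial sum of
   labels over the interval of [a]; so one of these labels is nonzero. *)
have := potential_below alpha (x0 + j%:Z, y - k%:Z).
rewrite [RHS](partial_line_sum alpha0 ez az) (pot _ _ hz hk)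
  (_ : _ - (0, 1) = (x0 + j%:Z, y - 1 - k%:Z)); last first.
  by apply/eqP; rewrite pointE /=; lia.
move=> E; case: (pickP [pred i | link P false (pt a) (pt i) && (alpha i != 0)]).
  by move=> i /andP[ai /eqP]; exists i.
move=> N; case/eqP: ne; apply/eqP; rewrite -subr_eq0; apply/eqP; rewrite E.
apply: big1 => i /andP[ai _]; have := N i; rewrite /= ai /=.
by move/negbFE/eqP.
Qed.

End Rectangle.

Section Ideal.
Variables (R : comNzRingType) (G : R -> Prop).

Lemma ideal0 : generated_ideal G 0.
Proof. by exists [::]; rewrite big_nil. Qed.

Lemma idealD f g : generated_ideal G f -> generated_ideal G g -> generated_ideal G (f + g).
Proof.
move=> [s [sG ->]] [t [tG ->]]; exists (s ++ t); rewrite big_cat; split=> //= p.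
by rewrite mem_cat => /orP[/sG|/tG].
Qed.

Lemma idealM c f : generated_ideal G f -> generated_ideal G (c * f).
Proof.
move=> [s [sG ->]]; exists [seq (c * p.1, p.2) | p <- s]; split.
  by move=> q /mapP[p ps ->]; apply: (sG p ps).
by rewrite big_map mulr_sumr; apply: eq_bigr => p _; rewrite mulrA.
Qed.

Lemma ideal_gen g : G g -> generated_ideal G g.
Proof.
move=> Gg; exists [:: (1, g)]; rewrite big_seq1 mul1r; split=> // p.
by rewrite inE => /eqP ->.
Qed.

End Ideal.

Section Balancing.
Variables (K : fieldType) (P : {fset cell}).
Local Notation n := #|{: polyomino_vertices P}|.
Implicit Types u v w : 'X_{1..n}.

Definition ideal_eq u v : Prop :=
  polyomino_ideal ('X_[u] - 'X_[v] : polyomino_ring K P).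

Lemma ideal_eq_refl u : ideal_eq u u.
Proof. by rewrite /ideal_eq subrr; apply: ideal0. Qed.

Lemma ideal_eq_sym u v : ideal_eq u v -> ideal_eq v u.
Proof. by move=> uv; rewrite /ideal_eq -opprB -mulN1r; apply: idealM. Qed.

Lemma ideal_eq_trans v u w : ideal_eq u v -> ideal_eq v w -> ideal_eq u w.
Proof.
by move=> uv vw; rewrite /ideal_eq -(subrK 'X_[v] 'X_[u]) -addrA; apply: idealD.
Qed.

Lemma ideal_eq_add w u v : ideal_eq u v -> ideal_eq (u + w)%MM (v + w)%MM.
Proof. by move=> uv; rewrite /ideal_eq !mpolyXD -mulrBl mulrC; apply: idealM. Qed.

Lemma ideal_eq_minor (a b c d : 'I_n) : inner_interval P (pt a) (pt b) ->
  pt c = ((pt a).1, (pt b).2) -> pt d = ((pt b).1, (pt a).2) ->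
  ideal_eq (U_(a) + U_(b))%MM (U_(c) + U_(d))%MM.
Proof.
move=> ab ec ed; rewrite /ideal_eq !mpolyXD; apply: ideal_gen.
exists (enum_val a), (enum_val b), (enum_val c), (enum_val d).
by rewrite /xvar !enum_valK.
Qed.

Lemma thin_unique (T : finType) (f : 'I_n -> T) u i j :
  (marginal f (f i) u <= 1)%N -> (0 < u i)%N -> f i = f j -> j <> i -> u j = 0%N.
Proof.
move=> h ui fij /eqP ji; move: h.
by rewrite /marginal (bigD1 i) //= (bigD1 j) /= ?fij ?eqxx ?ji //; lia.
Qed.

Lemma simple_exchange : {in P, forall C, lep 0 C} -> simple_polyomino P ->
  forall u v, same_marginals (line_class false) (line_class true) u v ->
  u != 0%MM -> (forall t, (marginal (line_class false) t u <= 1)%N) ->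
  (forall i, (u i == 0)%N || (v i == 0)%N) ->
  has_exchange (line_class false) (line_class true) ideal_eq u v.
Proof.
move=> P0 Psim u v [Hh Hg] /mnm_gt0[i0 ui0] thin disj.
pose alpha i : int := (u i)%:Z - (v i)%:Z.
have alpha0 d t : \sum_(i | line_class d i == t) alpha i = 0.
  rewrite /alpha sumrB -!(big_morph Posz PoszD (erefl 0%:Z)); apply/eqP.
  by rewrite subr_eq0 eqz_nat; case: d t => t; apply/eqP; [apply: Hg | apply: Hh].
have alphaE i : alpha i <> 0 -> (0 < u i)%N || (0 < v i)%N by rewrite /alpha; lia.
pose supp i := (0 < u i)%N || (0 < v i)%N.
have supp0 : supp i0 by rewrite /supp ui0.
(* A highest point of the support selects the horizontal interval; it meets both [u] and [v], by
   thinness in one point [p] and one point [q]. *)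
case: (@Order.TotalTheory.arg_maxP _ _ _ i0 supp (fun i => (pt i).2) supp0) => m supp_m mmax.
pose cm := line_class false m.
have um : (0 < marginal (line_class false) cm u)%N.
  case/orP: supp_m => h; last rewrite (Hh cm);
    exact: leq_trans h (marginal_ge _ _ _).
have vm : (0 < marginal (line_class false) cm v)%N by rewrite -(Hh cm).
have [p pm up] := marginal_gt0 um; have [q qm vq] := marginal_gt0 vm.
have thinv t : (marginal (line_class false) t v <= 1)%N by rewrite -(Hh t).
have pq : link P false (pt p) (pt q) by apply/line_classP; rewrite pm qm.
have mp : link P false (pt m) (pt p) by apply/line_classP; rewrite pm.
have upq := disj p; have vpq := disj q.
have ne : (pt p).1 <> (pt q).1.
  move=> e; have epq : p = q.
    apply: pt_inj; apply/eqP; rewrite pointE e eqxx /=.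
    by have /= -> := link_coordN pq.
  by move: upq up vq; rewrite -epq; lia.
have top i : alpha i <> 0 -> (pt i).2 <= (pt p).2.
  by move=> /alphaE /mmax; have /= -> := link_coordN mp.
have ap : alpha p <> 0 by rewrite /alpha; lia.
have aq : alpha q <> 0 by rewrite /alpha; lia.
have alone i : link P false (pt p) (pt i) -> i <> p -> i <> q -> alpha i = 0.
  move=> pi ip iq; have ui := thin_unique (thin _) up (elimT (line_classP _ _ _) pi) ip.
  have qi : link P false (pt q) (pt i) by apply: link_trans pi; rewrite link_sym.
  have vi := thin_unique (thinv _) vq (elimT (line_classP _ _ _) qi) iq.
  by rewrite /alpha ui vi.
have suppu a i : link P false (pt a) (pt i) -> alpha i <> 0 ->
    (0 < marginal (line_class false) (line_class false a) u)%N.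
  move=> /line_classP -> /alphaE /orP[]; last rewrite (Hh (line_class false i));
    move=> h; exact: leq_trans h (marginal_ge _ _ _).
have rowNe a b c d : inner_interval P (pt a) (pt b) -> (pt c).2 = (pt b).2 ->
    (pt d).2 = (pt a).2 -> line_class false c <> line_class false d.
  by move=> [_ h _] ec ed /line_classP /link_coordN /=; lia.
have eqy := link_coordN pq; rewrite /= in eqy.
(* The order of [p] and [q] decides whether [p] is an anti-diagonal or a diagonal corner of the
   rectangle, hence the sign of the minor. *)
case: (ltP (pt p).1 (pt q).1) => lt.
  have [i pi iq ip|a [b [inn [ep eb] [pa qb] ab [i ai hi]]]] :=
    exists_inner_rectangle alpha0 P0 Psim pq lt ap _ top => //.
    by apply: alone => // e; rewrite e in iq; lia.
  exists p, q, a, b; split.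
  - by [].
  - by split; apply/line_classP.
  - by split; apply/line_classP.
  - split; last exact: suppu ai hi.
    by apply: rowNe inn _ _.
  by rewrite addmC; apply: ideal_eq_sym; rewrite (addmC (U_(b))%MM); apply: ideal_eq_minor.
have qp : link P false (pt q) (pt p) by rewrite link_sym.
have {}lt : (pt q).1 < (pt p).1 by lia.
have topq i : alpha i <> 0 -> (pt i).2 <= (pt q).2 by rewrite -eqy; apply: top.
have [i qi ip iq|b [a [inn [eq ea] [qb pa] ba [i bi hi]]]] :=
    exists_inner_rectangle alpha0 P0 Psim qp lt aq _ topq => //.
  apply: alone => //; first exact: link_trans qi.
  by move=> e; rewrite e in ip; lia.
exists p, q, a, b; split.
- by [].
- by split; apply/line_classP; rewrite // link_sym.
- by split; apply/line_classP.
- split; first by apply: rowNe inn _ _ => //; rewrite ea.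
  by apply: suppu hi; apply: link_trans bi; rewrite link_sym.
by rewrite addmC (addmC (U_(a))%MM); apply: ideal_eq_minor.
Qed.

Lemma label_binomialE (alpha : polyomino_vertices P -> int) :
  label_binomial K alpha =
  'X_[[multinom pos_part (alpha (enum_val i)) | i < n]] -
  'X_[[multinom pos_part (- alpha (enum_val i)) | i < n]].
Proof.
have E (f : polyomino_vertices P -> nat) :
    \prod_v xvar K v ^+ f v = 'X_[[multinom f (enum_val i) | i < n]].
  rewrite mpolyXE_id (reindex enum_rank) /=; last exact: onW_bij (enum_rank_bij _).
  by apply: eq_bigr => v _; rewrite mnmE enum_rankK.
by rewrite /label_binomial !E.
Qed.

Lemma simple_balanced : {in P, forall C, lep 0 C} -> simple_polyomino P -> balanced K P.
Proof.
move=> P0 Psim alpha adm; rewrite label_binomialE.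
apply: (@sim_same_marginals _ _ _ (line_class false) (line_class true) ideal_eq).
- exact: ideal_eq_refl.
- exact: ideal_eq_trans.
- exact: ideal_eq_add.
- exact: simple_exchange.
have marg d t : marginal (line_class d) t [multinom pos_part (alpha (enum_val i)) | i < n] =
    marginal (line_class d) t [multinom pos_part (- alpha (enum_val i)) | i < n].
  apply/eqP; rewrite -eqz_nat -subr_eq0 /marginal.
  rewrite !(big_morph Posz PoszD (erefl 0%:Z)) -sumrB; apply/eqP.
  under eq_bigr => i _.
    rewrite !mnmE (_ : _ - _ = alpha (enum_val i)); last by rewrite /pos_part; lia.
    over.
  case: (pickP [pred i : 'I_n | line_class d i == t]) => [i /eqP it|N]; last first.
    by rewrite big_pred0.
  rewrite -[RHS](admissible_link d (enum_val i) adm) (reindex enum_rank) /=; last first.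
    exact: onW_bij (enum_rank_bij _).
  apply: eq_big => [v|v _]; last by rewrite enum_rankK.
  rewrite -it eq_sym; apply/eqP/idP => [/line_classP|vi]; first by rewrite /pt enum_rankK.
  by apply/line_classP; rewrite /pt enum_rankK.
by split=> t; apply: marg.
Qed.

End Balancing.

(** * Balanced polyominoes are simple *)

Lemma cell_adj_sym C D : cell_adj C D = cell_adj D C.
Proof. by rewrite /cell_adj fsetIC andbC. Qed.

Lemma cell_adj_direction d (C : cell) : cell_adj C (C + direction d).
Proof.
rewrite /cell_adj.
have -> : vertices C `&` vertices (C + direction d) = unit_edge (~~ d) (C + direction d).
  by apply/fsetP=> z; case: d; rewrite !inE !pointE /=; lia.
have e0 (D : cell) k : (k < 4)%N -> nth fset0 (edges D) k \in edges D.
  by move=> k4; apply: mem_nth.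
by apply/andP; case: d; split; [exact: (e0 C 2%N) | exact: (e0 _ 0%N)
  | exact: (e0 C 1%N) | exact: (e0 _ 3%N)].
Qed.

(** * Square boxes as rectangular polyominoes *)

Definition box (N : nat) : {fset cell} :=
  seq_fset tt [seq (i%:Z, j%:Z) | i <- iota 0 N, j <- iota 0 N].

Lemma boxP N (C : cell) :
  (C \in box N) = (0 <= C.1 < N%:Z) && (0 <= C.2 < N%:Z).
Proof.
rewrite seq_fsetE; apply/allpairsP/idP => [[[i j] [/=]]|H].
  by rewrite !mem_iota => hi hj -> /=; lia.
exists (`|C.1|%N, `|C.2|%N); rewrite !mem_iota; split=> /=; [lia | lia |].
by apply/eqP; rewrite pointE /=; lia.
Qed.

Definition joined (I : {fset cell}) (C D : cell) : Prop :=
  exists s, [/\ path cell_adj C s, {subset s <= I} & last C s = D].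

Lemma joined_trans I C D E : joined I C D -> joined I D E -> joined I C E.
Proof.
move=> [s [ps sI <-]] [t [pt tI <-]]; exists (s ++ t).
by rewrite cat_path ps last_cat; split=> // F; rewrite mem_cat => /orP[/sI|/tI].
Qed.

Lemma joined_step (I : {fset cell}) C D : cell_adj C D -> D \in I -> joined I C D.
Proof.
by move=> CD DI; exists [:: D]; rewrite /= CD; split=> // E; rewrite inE => /eqP ->.
Qed.

(** Lowering a positive coordinate by 1 stays in the box; induct on the sum of the coordinates. *)
Lemma box_joined0 N (C : cell) : C \in box N -> joined (box N) C 0 /\ joined (box N) 0 C.
Proof.
move: {2}(`|C.1| + `|C.2|)%N (leqnn (`|C.1| + `|C.2|)) => m.
elim: m C => [|m IH] C hC CB.
  have -> : C = 0 by apply/eqP; rewrite pointE /=; lia.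
  by split; exists [::].
case: (eqVneq C 0) => [->|C0]; first by split; exists [::].
have [d dC] : exists d, 0 < coord d C.
  by move: CB C0; rewrite boxP pointE /=; case: (ltP 0 C.1) => h;
    [exists false | exists true => /=; lia].
have DB : C - direction d \in box N by move: CB dC; rewrite !boxP; case: d => /=; lia.
have CD : cell_adj (C - direction d) C.
  by rewrite -{2}(subrK (direction d) C); apply: cell_adj_direction.
have [|D0 D1] := IH _ _ DB; first by move: CB dC hC; rewrite boxP; case: d {DB CD} => /=; lia.
split; last exact: joined_trans D1 (joined_step CD CB).
by apply: joined_trans D0; apply: joined_step DB; rewrite cell_adj_sym CD.
Qed.

Lemma box_rectangular N : (0 < N)%N -> rectangular (box N).
Proof.
move=> N0; split.
  split.
  - by apply/fset0Pn; exists 0; rewrite boxP /=; lia.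
  - by move=> C; rewrite boxP /lep /=; lia.
  - move=> C D /box_joined0[C0 _] /box_joined0[_ D0]; exact: joined_trans C0 D0.
exists 0, (N%:Z, N%:Z) => C; rewrite boxP cell_inP /=.
by split=> [H|[h1 h2 h3 h4]]; [split|]; lia.
Qed.

(** * The admissible labeling attached to a function on cells *)

Section Coboundary.
Variables (P : {fset cell}) (w : point -> int).
Hypothesis w_edge : forall d z, ~~ is_edge P d z -> w z = w (z - direction (~~ d)).

Lemma w_below (x y : int) : ~~ is_edge P false (x, y) -> w (x, y) = w (x, y - 1).
Proof.
move=> /w_edge ->; congr w; apply/eqP; rewrite pointE /=; lia.
Qed.

Lemma w_left (x y : int) : ~~ is_edge P true (x, y) -> w (x, y) = w (x - 1, y).
Proof.
move=> /w_edge ->; congr w; apply/eqP; rewrite pointE /=; lia.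
Qed.

(** The mixed second difference of [w] over the four cells around [z]; for [w] of bounded support,
    its potential is [- w]. *)
Definition corner_label (z : point) : int :=
  w (z.1, z.2) - w (z.1 - 1, z.2) - w (z.1, z.2 - 1) + w (z.1 - 1, z.2 - 1).

Lemma corner_label0 (z : point) : z \notin polyomino_vertices P -> corner_label z = 0.
Proof.
case: z => x y; rewrite (vertex_is_edge _ false) negb_or.
rewrite (mkpointB false x y) => /andP[/w_below e1 /w_below e2].
by rewrite /corner_label /= e1 e2 (addrAC (w _)) subrr add0r addNr.
Qed.

Lemma sum_corner_label (a b : point) : a.1 <= b.1 + 1 -> a.2 <= b.2 + 1 ->
  \sum_(v : polyomino_vertices P | val v \in lattice_interval a b) corner_label (val v) =
  w (b.1, b.2) - w (a.1 - 1, b.2) - w (b.1, a.2 - 1) + w (a.1 - 1, a.2 - 1).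
Proof.
move=> h1 h2.
have [m mE] : exists m : nat, m%:Z = b.1 + 1 - a.1 by exists (absz (b.1 + 1 - a.1)%R); lia.
have [k kE] : exists k : nat, k%:Z = b.2 + 1 - a.2 by exists (absz (b.2 + 1 - a.2)%R); lia.
pose g (i j : nat) : point := (a.1 + i%:Z, a.2 + j%:Z).
pose s := [seq g i j | i <- iota 0 m, j <- iota 0 k].
have s_uniq : uniq s.
  apply: allpairs_uniq; try exact: iota_uniq.
  by move=> [i j] [i' j'] _ _ /= [e1 e2]; congr pair; lia.
have sE z : (z \in s) = (z \in lattice_interval a b).
  apply/allpairsP/idP => [[[i j] [/=]]|].
    by rewrite !mem_iota inE /lep => hi hj -> /=; lia.
  rewrite inE /lep => hz; exists (`|z.1 - a.1|%N, `|z.2 - a.2|%N).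
  by rewrite !mem_iota; split=> /=; [lia | lia | apply/eqP; rewrite pointE /=; lia].
(* Lattice points that are not vertices of [P] contribute 0, so the sum may run over the full grid,
   where it telescopes in both directions. *)
transitivity (\sum_(z <- s) corner_label z).
  rewrite -(big_seq_fsetE _ _ (mem (lattice_interval a b)) corner_label) /=.
  rewrite [RHS](bigID (mem (polyomino_vertices P))) /=.
  rewrite [X in _ + X]big1 ?addr0; last by move=> z; apply: corner_label0.
  rewrite -big_filter -[RHS]big_filter; apply: perm_big; apply: uniq_perm.
  - by rewrite filter_uniq // fset_uniq.
  - by rewrite filter_uniq.
  - by move=> z; rewrite !mem_filter sE andbC.
rewrite big_allpairs_dep.
pose G (i j : nat) := w (a.1 + i%:Z - 1, a.2 + j%:Z - 1).
have GE i j : corner_label (g i j) = (G i.+1 j.+1 - G i j.+1) - (G i.+1 j - G i j).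
  have e (c : int) (l : nat) : c + l.+1%:Z - 1 = c + l%:Z by lia.
  by rewrite /corner_label /G /g /= !e; lia.
have row i : \sum_(j <- iota 0 k) corner_label (g i j) =
    (G i.+1 k - G i k) - (G i.+1 0%N - G i 0%N).
  rewrite -(telescope_sumr (fun j => G i.+1 j - G i j) (leq0n _)) /index_iota subn0.
  by apply: eq_bigr => j _; rewrite GE.
under eq_bigr => i _ do rewrite row.
pose L j := G m j - G 0%N j.
have col j : \sum_(i <- iota 0 m) (G i.+1 j - G i j) = L j.
  by rewrite /L -(telescope_sumr (G ^~ j) (leq0n _)) /index_iota subn0.
rewrite sumrB !col /L /G.
have -> : a.1 + m%:Z - 1 = b.1 by lia.
have -> : a.2 + k%:Z - 1 = b.2 by lia.
by rewrite !addr0 opprB [LHS]addrA [LHS]addrAC.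
Qed.

(** The sum over an interval reduces to the changes of [w] across the two unit edges just beyond its
    ends, which are missing by maximality. *)
Lemma corner_label_admissible :
  admissible (fun v : polyomino_vertices P => corner_label (val v)).
Proof.
move=> a b ab.
have [d max] : exists d, maximal_interval (edge_interval P d) a b.
  by case: ab => ab; [exists false | exists true].
have [e1 e2] := maximal_interval_ends max.
have [/edge_intervalP[eab ltab _] _] := max.
rewrite sum_corner_label; [|by case: d eab ltab {max e1 e2} => /=; lia..].
have cancel (x y z t : int) :
    (x = y /\ z = t) \/ (x = z /\ y = t) -> x - y - z + t = 0 by lia.
apply: cancel; case: d eab e1 e2 {ltab max} => /= <- e1 e2; [left | right].
  by split; exact: w_left.
by split; exact: w_below.
Qed.

(* Giving weight [1] to the variables of the vertices weakly to the left of [C]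
   and strictly above it, and weight [0] to the other ones, makes all inner
   minors homogeneous when [C] is not in [P], whereas the weights of the two
   monomials of the binomial of the corner labeling differ by [w C]. *)
Lemma balanced_cell0 (K : fieldType) (N : nat) (C : cell) : balanced K P ->
  {in P, forall D, lep 0 D} -> (forall z, w z <> 0 -> z \in box N) ->
  C \notin P -> w C = 0.
Proof.
move=> bal P0 wbox CP; apply/eqP/negPn/negP => /eqP wC.
have CB := wbox _ wC; rewrite boxP in CB.
have [M0 HM0] := fset_points_bounded (polyomino_vertices P).
(* The height [M] exceeds all vertices and the box, so [R] stands for the whole quadrant left of [C]
   and above it. *)
have [M [M0M NM]] : exists M : nat, (M0 <= M)%N /\ (N <= M)%N.
  by exists (M0 + N)%N; rewrite leq_addr leq_addl.
pose R := lattice_interval (0, C.2 + 1) (C.1, M%:Z).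
have weight_minor (p q : point) : p.1 < q.1 -> p.2 < q.2 ->
    ~~ [&& p.1 <= C.1, C.1 < q.1, p.2 <= C.2 & C.2 < q.2] ->
    0 <= p.1 -> 0 <= q.1 -> p.2 <= M%:Z -> q.2 <= M%:Z ->
    ((p \in R) + (q \in R) = ((p.1, q.2) \in R) + ((q.1, p.2) \in R))%N.
  by move=> *; rewrite !inE /lep /=; lia.
pose deg (i : 'I_#|{: polyomino_vertices P}|) : nat := pt i \in R.
(* Substituting ['X] to the power of its weight for each variable kills the inner minors, hence the
   ideal. *)
pose phi : {rmorphism polyomino_ring K P -> {poly K}} :=
  mmap (@polyC K) (fun i => 'X ^+ deg i).
have phiX m : phi 'X_[m] = 'X^(\sum_i (deg i * m i)%N).
  rewrite [LHS]mmapX /mmap1 -prodrXr; apply: eq_bigr => i _.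
  by rewrite exprM.
have phi_minor g : inner_minor g -> phi g = 0.
  move=> [a [b [c [d [[ab1 ab2 inn] ec ed ->]]]]].
  have nC : ~~ [&& (val a).1 <= C.1, C.1 < (val b).1, (val a).2 <= C.2 & C.2 < (val b).2].
    by apply: contra CP => /and4P H; apply: inn; apply/cell_inP.
  have pt_bounds (v : polyomino_vertices P) : 0 <= (val v).1 /\ (val v).2 <= M%:Z.
    have := vertex_nonneg P0 (valP v); have := HM0 _ (valP v).
    by rewrite /lep /=; lia.
  have phi_xvar v : phi (xvar K v) = 'X^(val v \in R).
    by rewrite [LHS]mmapX mmap1U /deg /pt enum_rankK.
  rewrite rmorphB !rmorphM !phi_xvar -!exprD.
  rewrite ec ed weight_minor ?subrr //.
  - exact: (pt_bounds a).1.
  - exact: (pt_bounds b).1.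
  - exact: (pt_bounds a).2.
  - exact: (pt_bounds b).2.
have /(_ _ corner_label_admissible) := bal; rewrite label_binomialE => -[s [sG E]].
have := congr1 phi E.
rewrite rmorph_sum big_seq big1 => [|p ps]; last first.
  by rewrite rmorphM /= (phi_minor _ (sG _ ps)) mulr0.
rewrite rmorphB !phiX => /eqP; rewrite subr_eq0 => /eqP eX.
have := congr1 (fun p : {poly K} => (size p).-1) eX; rewrite !size_polyXn /= => {eX} /eqP.
rewrite -eqz_nat -subr_eq0 !(big_morph Posz PoszD (erefl 0%:Z)) -sumrB => /eqP Es.
have outside (x y : int) : (x < 0) || (N%:Z <= y) -> w (x, y) = 0.
  by move=> xy; apply/eqP/negPn/negP => /eqP /wbox; rewrite boxP /=; lia.
have S : \sum_(v : polyomino_vertices P | val v \in R) corner_label (val v) = - w C.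
  (* Of the four corner terms only the one at [C] lies in the box. *)
  rewrite sum_corner_label /=; [|lia..].
  rewrite (outside C.1) ?(outside (0 - 1)) ?addr0 ?subr0 ?sub0r ?addrK; [|lia..].
  by case: (C).
apply: wC; apply/eqP; rewrite -oppr_eq0 -S; apply/eqP.
rewrite -[RHS]Es (reindex (fun i : 'I_#|{: polyomino_vertices P}| => enum_val i)) /=;
  last first.
  exact: onW_bij (enum_val_bij _).
rewrite big_mkcond; apply: eq_bigr => i _; rewrite /deg !mnmE /pt.
by case: ifP => _ /=; rewrite ?mul0n ?mul1n ?subrr // /pos_part; lia.
Qed.

End Coboundary.

Lemma balanced_simple (K : fieldType) (P : {fset cell}) :
  polyomino P -> balanced K P -> simple_polyomino P.
Proof.
move=> [Pn0 P0 _] bal; have [N HN] := fset_points_bounded P.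
have PB : P `<=` box N.
  by apply/fsubsetP=> C CP; have := P0 _ CP; have := HN _ CP; rewrite boxP /lep /=; lia.
have N0 : (0 < N)%N by case/fset0Pn: Pn0 => C /HN; lia.
exists (box N); split=> //; first exact: box_rectangular.
move=> C CP.
pose reach D := exists s, [/\ path cell_adj C s, {in C :: s, forall D, D \notin P}
  & last C s = D].
have reachP D : reach D -> D \notin P.
  by move=> [s [_ sP <-]]; apply: sP; apply: mem_last.
have reachS D E : reach D -> cell_adj D E -> E \notin P -> reach E.
  move=> [s [ps sP eD]] DE EP; exists (rcons s E); rewrite rcons_path ps eD DE last_rcons.
  by split=> // F; rewrite -rcons_cons mem_rcons inE => /predU1P[->|/sP].
(* Either the component of [C] in the complement leaves the box, and a path shortened to distinct
   cells is the required one, or its indicator [w] is supported in the box and contradicts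
   [balanced_cell0]. *)
case: (excluded_middle_informative (exists2 D, reach D & D \notin box N)) => [|NE].
  move=> [D [s [ps sP eD]] DB]; rewrite -eD in DB.
  case/shortenP: ps DB => t pt ut ts DB; exists t; split=> // F.
  by rewrite inE => /predU1P[->|/ts Fs]; apply: sP; rewrite inE ?eqxx ?Fs ?orbT.
pose w D : int := if excluded_middle_informative (reach D) then 1 else 0.
have w1 D : reach D -> w D = 1 by rewrite /w; case: excluded_middle_informative.
have w0 D : ~ reach D -> w D = 0 by rewrite /w; case: excluded_middle_informative.
have w_adj D E : cell_adj D E -> D \notin P -> E \notin P -> w D = w E.
  move=> DE DP EP; rewrite /w.
  case: excluded_middle_informative => rD; case: excluded_middle_informative => rE //.
    by case: rE; apply: reachS rD DE EP.
  by case: rD; apply: reachS rE _ DP; rewrite cell_adj_sym.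
suff : w C = 0 by rewrite w1 //; exists [::]; split=> // D; rewrite inE => /eqP ->.
apply: (@balanced_cell0 P w _ K N C bal P0) => // [d z|z wz].
  rewrite /is_edge negb_or => /andP[zP zP']; apply: w_adj => //.
  by rewrite cell_adj_sym -{2}(subrK (direction (~~ d)) z); apply: cell_adj_direction.
apply/negPn/negP => zB; apply: NE; exists z => //.
by move: wz; rewrite /w; case: excluded_middle_informative.
Qed.

Theorem theorem2p1 (K : fieldType) (P : {fset cell}) (hP : polyomino P) :
  simple_polyomino P <-> balanced K P.
Proof.
split; last exact: balanced_simple.
by apply: simple_balanced; case: hP.
Qed.
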